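(* Let $Q_{\mathrm{init}}\le Q^\star$ be the initial and terminal capacities. Assume that feasible policies satisfy $0\le q_t\le Q^\star-Q_t$ for all $t$ (no overbuild) and that the mapping $S(Q)=Q+\bar q(Q)$ is non-decreasing on $[Q_{\mathrm{init}},Q^\star)$ (monotone reachability). Then the myopic policy is globally optimal (for every finite horizon it maximizes the cumulative expansion $\sum_t q_t$ among feasible policies) and it weakly dominates every feasible policy $\mathcal P$: $$Q_t^{\mathrm{myo}}\ \ge\ Q_t^{\mathcal P}\qquad\text{for all } t\ge 0 .$$
   Context: Constants: $M>0$, $\epsilon>0$, $k>0$. Real-valued functions of the renewable capacity $Q\ge 0$: emissions intensity $e(Q)>0$ with $e'(Q)<0$; delivered renewable electricity $f(Q)\ge 0$ with $f(0)=0$, $f'(Q)>0$, $f''(Q)<0$; marginal wholesale value $\pi(Q)$ with $\pi'(Q)<0$; costs $C_R(Q)\ge 0$, $C_S(Q)\ge 0$. Demand is $D(x)=M\exp(-\epsilon x)$; revenue is $R(p,Q)=p\,D(p/e(Q))$; integrated non-investment cost is $C(Q)=C_S(Q)+C_R(Q)-f(Q)\pi(Q)$. A pair $(p,q)$ with $p,q\ge 0$ is feasible at state $Q$ if $D(p/e(Q))\le f(Q)$ and $C(Q)+kq\le R(p,Q)$. The maximal feasible one-step expansion is $$\bar q(Q)=\max\{q\ge 0:\ \exists\,p\ge 0 \text{ such that } (p,q)\text{ is feasible at } Q\},$$ understood to be well defined for $Q\in[Q_{\mathrm{init}},Q^\star]$. The terminal capacity $Q^\star$ is the long-run capacity limit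 at which expansion ceases. A feasible policy $\mathcal P=\{(p_t^{\mathcal P},q_t^{\mathcal P})\}_{t\ge 0}$ generates the trajectory $Q_0^{\mathcal P}=Q_{\mathrm{init}}$, $Q_{t+1}^{\mathcal P}=Q_t^{\mathcal P}+q_t^{\mathcal P}$, with $(p_t^{\mathcal P},q_t^{\mathcal P})$ feasible at state $Q_t^{\mathcal P}$ and $0\le q_t^{\mathcal P}\le Q^\star-Q_t^{\mathcal P}$ for every $t$. The myopic policy takes $Q_0^{\mathrm{myo}}=Q_{\mathrm{init}}$, $q_t^{\mathrm{myo}}=\min\{\bar q(Q_t^{\mathrm{myo}}),\,Q^\star-Q_t^{\mathrm{myo}}\}$, $Q_{t+1}^{\mathrm{myo}}=Q_t^{\mathrm{myo}}+q_t^{\mathrm{myo}}$ (with any price making the expansion feasible). *)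

(* Defs.v *)
From Stdlib Require Import Reals.
Open Scope R_scope.

Record market := Market {
  M : R;
  epsilon : R;
  k : R;
  intensity : R -> R;      (* e *)
  delivered : R -> R;      (* f *)
  wholesale : R -> R;      (* pi *)
  cost_R : R -> R;         (* C_R *)
  cost_S : R -> R          (* C_S *)
}.

Definition nonneg (Q : R) : Prop := 0 <= Q.

(* Functions of a capacity Q >= 0 are represented by total functions on R
   constrained only on [0, +oo); [D_in] is the derivative relative to that
   domain, hence the right derivative at Q = 0. *)
Definition derivative (g g' : R -> R) : Prop :=
  forall Q, 0 <= Q -> D_in g g' nonneg Q.

Record standing_assumptions (m : market) : Prop := {
  M_pos : 0 < M m;
  epsilon_pos : 0 < epsilon m;
  k_pos : 0 < k m;
  intensity_pos : forall Q, 0 <= Q -> 0 < intensity m Q;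
  intensity_decr : exists e' : R -> R,
    derivative (intensity m) e' /\ forall Q, 0 <= Q -> e' Q < 0;
  delivered_nonneg : forall Q, 0 <= Q -> 0 <= delivered m Q;
  delivered_0 : delivered m 0 = 0;
  delivered_incr_concave : exists f' f'' : R -> R,
    derivative (delivered m) f' /\ derivative f' f'' /\
    forall Q, 0 <= Q -> 0 < f' Q /\ f'' Q < 0;
  wholesale_decr : exists pi' : R -> R,
    derivative (wholesale m) pi' /\ forall Q, 0 <= Q -> pi' Q < 0;
  cost_R_nonneg : forall Q, 0 <= Q -> 0 <= cost_R m Q;
  cost_S_nonneg : forall Q, 0 <= Q -> 0 <= cost_S m Q
}.

Definition demand (m : market) (x : R) : R := M m * exp (- epsilon m * x).

Definition revenue (m : market) (p Q : R) : R :=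
  p * demand m (p / intensity m Q).

Definition cost (m : market) (Q : R) : R :=
  cost_S m Q + cost_R m Q - delivered m Q * wholesale m Q.

Definition feasible (m : market) (Q p q : R) : Prop :=
  0 <= p /\ 0 <= q /\
  demand m (p / intensity m Q) <= delivered m Q /\
  cost m Q + k m * q <= revenue m p Q.

Definition feasible_expansion (m : market) (Q q : R) : Prop :=
  0 <= q /\ exists p, 0 <= p /\ feasible m Q p q.

Definition is_max (E : R -> Prop) (b : R) : Prop := E b /\ is_upper_bound E b.

(* The maximum need not exist for an arbitrary market and state, so the
   maximal expansion is a function [qbar] specified on [Qinit, Qstar] only;
   it is unique there. *)
Definition max_expansion_on (m : market) (Qinit Qstar : R) (qbar : R -> R)
  : Prop :=
  forall Q, Qinit <= Q <= Qstar -> is_max (feasible_expansion m Q) (qbar Q).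

Definition nondecreasing_on (A : R -> Prop) (g : R -> R) : Prop :=
  forall x y, A x -> A y -> x <= y -> g x <= g y.

Record policy := Policy { price : nat -> R; expansion : nat -> R }.

Fixpoint capacity (Qinit : R) (P : policy) (t : nat) : R :=
  match t with
  | O => Qinit
  | S t' => capacity Qinit P t' + expansion P t'
  end.

(* [Qstar] enters only through the cap q_t <= Qstar - Q_t, which forces
   q_t = 0 once the capacity is Qstar: expansion ceases there. *)
Definition feasible_policy (m : market) (Qinit Qstar : R) (P : policy) : Prop :=
  forall t,
    feasible m (capacity Qinit P t) (price P t) (expansion P t) /\
    0 <= expansion P t <= Qstar - capacity Qinit P t.

(* The expansions are determined by [qbar]; the prices are any that make them
   feasible. *)
Definition myopic (m : market) (Qinit Qstar : R) (qbar : R -> R) (P : policy)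
  : Prop :=
  forall t,
    expansion P t =
      Rmin (qbar (capacity Qinit P t)) (Qstar - capacity Qinit P t) /\
    feasible m (capacity Qinit P t) (price P t) (expansion P t).

(* [sum_f_R0 u T] is the (T+1)-term sum u 0 + ... + u T. *)
Definition globally_optimal (m : market) (Qinit Qstar : R) (P : policy)
  : Prop :=
  feasible_policy m Qinit Qstar P /\
  forall P', feasible_policy m Qinit Qstar P' ->
  forall T, sum_f_R0 (expansion P') T <= sum_f_R0 (expansion P) T.

(* Main.v *)
(** A feasible policy expands from [Q] by at most [qbar Q] and by at most
    [Qstar - Q], so its next capacity is at most [Rmin (Q + qbar Q) Qstar];
    the myopic policy attains this bound.  As the bound is nondecreasing in [Q],
    a policy that is behind the myopic one stays behind, by induction on time.
    Optimality follows because the cumulative expansion is the final capacity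
    minus [Qinit]. *)
Require Import Defs.
From Stdlib Require Import Reals Lra IndefiniteDescription.
Open Scope R_scope.

(** At a fixed price, [q] enters only through the investment cost, so shrinking it keeps the budget
    constraint. This covers a [qbar Q] truncated by the cap. *)
Lemma feasible_le_expansion (m : market) (Q p q q' : R) :
  0 <= k m -> 0 <= q' <= q -> feasible m Q p q -> feasible m Q p q'.
Proof.
  intros hk hq (hp & _ & hD & hR).
  repeat split; try tauto.
  pose proof (Rmult_le_compat_l (k m) q' q hk (proj2 hq)). lra.
Qed.

Lemma capacity_sum (Qinit : R) (P : policy) (T : nat) :
  capacity Qinit P (S T) = Qinit + sum_f_R0 (expansion P) T.
Proof.
  induction T as [|T IH]; [reflexivity|].
  change (capacity Qinit P (S T) + expansion P (S T)
          = Qinit + (sum_f_R0 (expansion P) T + expansion P (S T))).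
  lra.
Qed.

Lemma capacity_bounds (m : market) (Qinit Qstar : R) (P : policy) :
  Qinit <= Qstar -> feasible_policy m Qinit Qstar P ->
  forall t, Qinit <= capacity Qinit P t <= Qstar.
Proof.
  intros hQ hP t; induction t as [|t IH]; simpl; [lra|].
  destruct (hP t); lra.
Qed.

Lemma myopic_expansion_bounds (m : market) (Qinit Qstar : R) (qbar : R -> R) :
  max_expansion_on m Qinit Qstar qbar ->
  forall Q, Qinit <= Q <= Qstar -> 0 <= Rmin (qbar Q) (Qstar - Q) <= Qstar - Q.
Proof.
  intros hqbar Q hQ; split; [|apply Rmin_r].
  apply Rmin_glb; [exact (proj1 (proj1 (hqbar Q hQ)))|lra].
Qed.

Lemma myopic_feasible_policy (m : market) (Qinit Qstar : R) (qbar : R -> R)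
  (P : policy) :
  Qinit <= Qstar -> max_expansion_on m Qinit Qstar qbar ->
  myopic m Qinit Qstar qbar P -> feasible_policy m Qinit Qstar P.
Proof.
  intros hQ hqbar hP.
  (* [capacity_bounds] would presuppose the feasibility being proved, and [qbar] is controlled only
     inside the interval, so the bounds come first by their own induction. *)
  assert (hb : forall t, Qinit <= capacity Qinit P t <= Qstar).
  { intro t; induction t as [|t IH]; simpl; [lra|].
    rewrite (proj1 (hP t)).
    pose proof (myopic_expansion_bounds _ _ _ _ hqbar _ IH); lra. }
  intro t; split; [apply hP|].
  rewrite (proj1 (hP t)).
  exact (myopic_expansion_bounds _ _ _ _ hqbar _ (hb t)).
Qed.

(** A price supporting [qbar Q] also supports the truncated expansion; choosing one at each state
    gives the policy. *)
Lemma myopic_exists (m : market) (Qinit Qstar : R) (qbar : R -> R) :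
  0 <= k m -> Qinit <= Qstar -> max_expansion_on m Qinit Qstar qbar ->
  exists P, myopic m Qinit Qstar qbar P.
Proof.
  intros hk hQ hqbar.
  set (q := fun Q => Rmin (qbar Q) (Qstar - Q)).
  (* The range condition sits under the existential so that choice applies to all of [R]; outside
     the interval, price 0 is a dummy. *)
  assert (hprice : forall Q, exists p,
            Qinit <= Q <= Qstar -> feasible m Q p (q Q)).
  { intro Q.
    destruct (Rle_dec Qinit Q); [|exists 0; lra].
    destruct (Rle_dec Q Qstar); [|exists 0; lra].
    assert (hQb : Qinit <= Q <= Qstar) by lra.
    destruct (hqbar Q hQb) as [(_ & p & _ & hp) _].
    exists p; intros _.
    apply (feasible_le_expansion m Q p (qbar Q)); [exact hk| |exact hp].
    split; [apply (myopic_expansion_bounds _ _ _ _ hqbar Q hQb)|apply Rmin_l]. }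
  destruct (functional_choice _ hprice) as [price_at hprice_at].
  (* [capacity] needs a policy, and the policy needs its capacities; a direct recursion breaks the
     circle. *)
  set (cap := fix cap (t : nat) : R :=
                match t with O => Qinit | S t => cap t + q (cap t) end).
  set (P := Policy (fun t => price_at (cap t)) (fun t => q (cap t))).
  assert (hcap : forall t, capacity Qinit P t = cap t).
  { intro t; induction t as [|t IH]; simpl; [|rewrite IH]; reflexivity. }
  assert (hb : forall t, Qinit <= cap t <= Qstar).
  { intro t; induction t as [|t IH]; simpl; [lra|].
    pose proof (myopic_expansion_bounds _ _ _ _ hqbar _ IH).
    unfold q; lra. }
  exists P; intro t; rewrite (hcap t); split; [reflexivity|].
  exact (hprice_at _ (hb t)).
Qed.

Lemma myopic_dominates (m : market) (Qinit Qstar : R) (qbar : R -> R)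
  (P P' : policy) :
  Qinit <= Qstar -> max_expansion_on m Qinit Qstar qbar ->
  nondecreasing_on (fun Q => Qinit <= Q < Qstar) (fun Q => Q + qbar Q) ->
  myopic m Qinit Qstar qbar P -> feasible_policy m Qinit Qstar P' ->
  forall t, capacity Qinit P' t <= capacity Qinit P t.
Proof.
  intros hQ hqbar hS hP hP' t.
  pose proof (capacity_bounds _ _ _ _ hQ
                (myopic_feasible_policy _ _ _ _ _ hQ hqbar hP)) as hb.
  pose proof (capacity_bounds _ _ _ _ hQ hP') as hb'.
  induction t as [|t IH]; simpl; [lra|].
  rewrite (proj1 (hP t)).
  destruct (hP' t) as [hf [_ hcap]].
  pose proof (hb t) as hbt; pose proof (hb' t) as hbt'.
  assert (hexp : expansion P' t <= qbar (capacity Qinit P' t)).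
  { apply (hqbar _ hbt').
    split; [apply hf|exists (price P' t); split; [apply hf|exact hf]]. }
  (* [Q + qbar Q] is monotone only below [Qstar]. *)
  destruct (Rlt_le_dec (capacity Qinit P t) Qstar) as [hlt|hge].
  (* By [IH] the trailing capacity is below [Qstar] too, so both states lie in the domain of
     [hS]. *)
  - assert (hmono := hS (capacity Qinit P' t) (capacity Qinit P t)
                       ltac:(lra) ltac:(lra) IH); simpl in hmono.
    (* If [qbar] is the minimum, [hexp] and [hmono] conclude; otherwise the myopic policy lands on
       [Qstar] and [hcap] does. *)
    unfold Rmin; destruct Rle_dec; lra.
  - pose proof (myopic_expansion_bounds _ _ _ _ hqbar _ hbt); lra.
Qed.

Theorem theorem3 (m : market) (hm : standing_assumptions m)
  (Qinit Qstar : R) (hQ0 : 0 <= Qinit) (hQ : Qinit <= Qstar)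
  (qbar : R -> R) (hqbar : max_expansion_on m Qinit Qstar qbar)
  (hS : nondecreasing_on (fun Q => Qinit <= Q < Qstar)
          (fun Q => Q + qbar Q)) :
  (exists P : policy, myopic m Qinit Qstar qbar P) /\
  (forall P : policy, myopic m Qinit Qstar qbar P ->
     globally_optimal m Qinit Qstar P /\
     (forall P' : policy, feasible_policy m Qinit Qstar P' ->
      forall t : nat, capacity Qinit P t >= capacity Qinit P' t)).
Proof.
  split.
  - apply (myopic_exists m); [apply Rlt_le, (k_pos m hm)|exact hQ|exact hqbar].
  - intros P hP.
    pose proof (fun P' => myopic_dominates m Qinit Qstar qbar P P' hQ hqbar hS hP)
      as hdom.
    split; [split|].
    + exact (myopic_feasible_policy m Qinit Qstar qbar P hQ hqbar hP).
    + intros P' hP' T.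
      (* The sum up to [T] has [T + 1] terms, hence the capacity at [S T]. *)
      pose proof (hdom P' hP' (S T)) as h.
      rewrite !capacity_sum in h; lra.
    + intros P' hP' t; apply Rle_ge, hdom, hP'.
Qed.
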